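(* Let $X$ be an approximately ultrahomogeneous (AUH) Banach space, let $Y\subseteq X$ be a subspace, and let $\gamma\in\mathrm{Emb}(Y,\mathrm{Env}(Y))$. Then $\mathrm{Env}(\gamma Y)=\mathrm{Env}(Y)$ if and only if $\gamma\in\mathrm{Emb}_{\mathrm{ext}}(Y,\mathrm{Env}(Y))$, that is, if and only if $\gamma$ is the restriction to $Y$ of a surjective linear isometry of $\mathrm{Env}(Y)$. In particular, any partial isometry between full subspaces of $X$ (i.e. any surjective linear isometry $t:Y_1\to Y_2$ with $Y_1,Y_2$ full subspaces of $X$) extends to a surjective linear isometry of $X$.
   Context: $\mathrm{Isom}(X)$ is the group of surjective linear isometries of $X$; $\mathrm{Emb}(Y,Z)$ is the set of linear isometric embeddings of $Y$ into $Z$, and for $Y\subseteq Z$, $\mathrm{Emb}_{\mathrm{ext}}(Y,Z)=\{T|_Y:T\in\mathrm{Isom}(Z)\}$. $X$ is approximately ultrahomogeneous (AUH) if for every finite-dimensional subspace $F$ of $X$, every $t\in\mathrm{Emb}(F,X)$ and every $\varepsilon>0$ there is $T\in\mathrm{Isom}(X)$ with $\|T|_F-t\|\le\varepsilon$. The isometric envelope $\mathrm{Env}(Y)$ (always taken in $X$) is the set of $x\in X$ such that whenever a net $(T_i)_{i}$ in $\mathrm{Isom}(X)$ satisfies $T_i y\to y$ for every $y\in Y$, then $T_i x\to x$. A subspace $Y$ of $X$ is full if $\mathrm{Env}(Y)=X$. *)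

(* Defs.v *)
From HB Require Import structures.
From mathcomp Require Import all_boot all_order all_algebra.
From mathcomp Require Import boolp classical_sets functions filter.
From mathcomp Require Import topology normedtype.

Set Implicit Arguments.
Unset Strict Implicit.
Unset Printing Implicit Defensive.

Import Order.TTheory GRing.Theory Num.Theory.
Import numFieldNormedType.Exports.

Local Open Scope classical_set_scope.
Local Open Scope ring_scope.

Section nets.
Context {I : Type} (le : I -> I -> Prop).

Record directed : Prop := Directed {
  directed_inhabited : inhabited I;
  directed_refl : forall i, le i i;
  directed_trans : forall j i k, le i j -> le j k -> le i k;
  directed_ub : forall i j, exists k, le i k /\ le j k }.

(* The net (u_i)_i converges to l when [u @ tails --> l]. *)
Definition tails : set_system I := filter_from setT (fun i => [set j | le i j]).

End nets.

Section embeddings.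
Context {K : numFieldType} {X : normedModType K}.
Implicit Types (F Y Z : set X) (f t : X -> X).

(* Linear subspaces are not required to be topologically closed. *)
Definition linear_subspace Y := GRing.submod_closed [in Y].

Definition finite_dim_subspace F := exists (n : nat) (e : 'I_n -> X),
  F = [set x | exists a : 'I_n -> K, x = \sum_(i < n) a i *: e i].

(* A map Y -> Z is represented by a total function X -> X,
   of which only the values on Y matter. *)
Definition linear_on Y f := forall (a : K) (x y : X),
  Y x -> Y y -> f (a *: x + y) = a *: f x + f y.

Definition Emb Y Z : set (X -> X) :=
  [set f : X -> X |
    [/\ set_fun Y Z f, linear_on Y f & forall x, Y x -> `|f x| = `|x|]].

Definition Isom Z : set (X -> X) :=
  [set f : X -> X | Emb Z Z f /\ set_surj Z Z f].

Definition Emb_ext Y Z : set (X -> X) :=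
  [set f : X -> X | exists2 T, Isom Z T & forall y, Y y -> f y = T y].

(* The inner inequality says that the operator norm of [T - t] on F,
   a supremum over the unit ball of F, is at most eps. *)
Definition AUH := forall F t, finite_dim_subspace F -> Emb F setT t ->
  forall eps : K, 0 < eps -> exists2 T, Isom setT T &
    forall x, F x -> `|x| <= 1 -> `|T x - t x| <= eps.

Definition Env Y : set X := [set x | forall (I : Type) (le : I -> I -> Prop)
    (T : I -> X -> X), directed le -> (forall i, Isom setT (T i)) ->
  (forall y, Y y -> T i y @[i --> tails le] --> y) ->
  T i x @[i --> tails le] --> x].

Definition full Y := Env Y = setT.

End embeddings.

Arguments AUH {K} X.

(* Main.v *)
Require Import Defs.
From mathcomp Require Import all_boot all_order all_algebra.
From mathcomp Require Import boolp classical_sets functions filter.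
From mathcomp Require Import topology normedtype.
Import numFieldNormedType.Exports.
Local Open Scope classical_set_scope.
Local Open Scope ring_scope.

(** Let [t] embed [Y] isometrically into [X].  Approximate ultrahomogeneity says
    that [t] is a pointwise limit on [Y] of surjective isometries [T] of [X]:
    the filter [pointwise Y t], generated by the sets of isometries that are
    close to [t] at finitely many points of [Y], is proper ([AUH_pointwise]).
    The envelope of [Y] is the set of points [x] where convergence to the
    identity on [Y] forces convergence of [T x] to [x] ([Env_pointwise]).

    If [S] and [T] are two isometries close to [t] on [Y], then [S^-1 T] is
    close to the identity on [Y], hence at every point [x] of [Env Y], so that
    [S x] and [T x] are close ([Env_uniform]).  Therefore [T x] is Cauchy along
    [pointwise Y t], and, [X] being complete, its limit [g x] defines an
    isometric extension [g] of [t] to [Env Y] ([Emb_Env]).  Three facts follow.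
    - [g] takes its values in [Env (t Y)]: for [U] close to the identity on
      [t Y] and [S] close to [t] on [Y], the isometries [S] and [U S] are close
      on [Y], hence at [x], so that [U] nearly fixes [S x] and its limit [g x]
      ([Env_image]).
    - [g] is the only isometric embedding of [Env Y] into [X] that extends [t]:
      any such embedding is itself approximated by isometries of [X], which are
      then close to [t] on [Y] ([Emb_Env_is_limit]).
    - [g] maps [Env Y] onto [Env (t Y)]: extend [t^-1] in the same way and
      apply uniqueness to the composite ([Emb_Env_surj]).

    So an embedding [gamma] of [Y] into [Env Y] has a unique isometric extension
    to [Env Y], whose range is [Env (gamma Y)].  This extension is a surjective
    isometry of [Env Y] if and only if [Env (gamma Y)] is [Env Y].  For an
    isometry between full subspaces both envelopes are [X], and the extension is
    a surjective isometry of [X]. *)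

(** * Isometric embeddings *)

Section normed_space.
Import Order.TTheory GRing.Theory Num.Theory.
Set Implicit Arguments.
Unset Strict Implicit.
Unset Printing Implicit Defensive.
Context {K : numFieldType} {X : normedModType K}.
Implicit Types (Y Z : set X) (f t S T U : X -> X) (s : seq X) (x y z u v w : X).

Lemma linear_on0 Y f : linear_subspace Y -> linear_on Y f -> f 0 = 0.
Proof.
move=> [Y0 _] lf; have {}Y0 : Y 0 by rewrite -in_setE.
by have := lf (-1) _ _ Y0 Y0; rewrite scaler0 addr0 scaleN1r addNr.
Qed.

Lemma linear_onZ Y f a x : linear_subspace Y -> linear_on Y f -> Y x ->
  f (a *: x) = a *: f x.
Proof.
move=> sY lf Yx; rewrite -[a *: x]addr0 lf//; last by apply/set_mem/(proj1 sY).
by rewrite (linear_on0 sY lf) addr0.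
Qed.

Lemma linear_onB Y f x y : linear_on Y f -> Y x -> Y y -> f (x - y) = f x - f y.
Proof.
by move=> lf Yx Yy; rewrite addrC -scaleN1r lf // scaleN1r addrC.
Qed.

Lemma subspaceB Y x y : linear_subspace Y -> Y x -> Y y -> Y (x - y).
Proof.
move=> [_ lY] Yx Yy; rewrite addrC -scaleN1r -in_setE.
by apply: lY; apply/mem_set.
Qed.

Lemma Emb_dist Y Z f x y : linear_subspace Y -> Emb Y Z f -> Y x -> Y y ->
  `|f x - f y| = `|x - y|.
Proof.
move=> sY [_ lf nf] Yx Yy.
by rewrite -(linear_onB lf)// nf//; exact: subspaceB.
Qed.

Lemma Emb_inj Y Z f x y : linear_subspace Y -> Emb Y Z f -> Y x -> Y y ->
  f x = f y -> x = y.
Proof.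
move=> sY fE Yx Yy fxy; apply/subr0_eq/normr0_eq0.
by rewrite -(Emb_dist sY fE)// fxy subrr normr0.
Qed.

Lemma subspace_setT : linear_subspace [set: X].
Proof. by split=> [|? ? ? _ _]; rewrite in_setE. Qed.

Lemma subspace_image Y Z f : linear_subspace Y -> Emb Y Z f ->
  linear_subspace (f @` Y).
Proof.
move=> sY [_ lf _]; have [Y0 lY] := sY; split=> [|a u v].
  by apply/mem_set; exists 0; [exact/set_mem|exact: linear_on0 sY lf].
rewrite !in_setE => -[x Yx <-] [y Yy <-]; exists (a *: x + y); last exact: lf.
by apply/set_mem/lY; exact/mem_set.
Qed.

Lemma Emb_sub Y Z Y' Z' f : Y' `<=` Y -> set_fun Y' Z' f -> Emb Y Z f ->
  Emb Y' Z' f.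
Proof.
by move=> sub sf [_ lf nf]; split=> // [a x y /sub Yx /sub Yy|x /sub Yx]; auto.
Qed.

Lemma Isom_norm T x : Isom setT T -> `|T x| = `|x|.
Proof. by case=> -[_ _ nT] _; exact: nT. Qed.

Lemma Isom_linear T a x y : Isom setT T -> T (a *: x + y) = a *: T x + T y.
Proof. by case=> -[_ lT _] _; exact: lT. Qed.

Lemma Isom0 T : Isom setT T -> T 0 = 0.
Proof. by case=> -[_ lT _] _; exact: linear_on0 subspace_setT lT. Qed.

Lemma IsomZ T a x : Isom setT T -> T (a *: x) = a *: T x.
Proof. by case=> -[_ lT _] _; exact: linear_onZ subspace_setT lT _. Qed.

Lemma Isom_dist T x y : Isom setT T -> `|T x - T y| = `|x - y|.
Proof. by case=> TE _; exact: (Emb_dist subspace_setT TE). Qed.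

Lemma Isom_id : Isom [set: X] id.
Proof. by split; [split|move=> x _; exists x]. Qed.

Lemma Isom_comp S T : Isom setT S -> Isom setT T -> Isom setT (S \o T).
Proof.
move=> SI TI; split; last first.
  move=> z _; have [y _ <-] := SI.2 z I; have [x _ <-] := TI.2 y I.
  by exists x.
split=> // [a x y _ _|x _] /=; first by rewrite !Isom_linear.
by rewrite !Isom_norm.
Qed.

(** [R] is [S^-1 T]. *)
Lemma Isom_quotient S T : Isom setT S -> Isom setT T ->
  exists2 R, Isom setT R & forall x, S (R x) = T x.
Proof.
move=> SI TI.
have /choice[R SR] : forall x, exists u, S u = T x.
  by move=> x; have [u _ <-] := SI.2 (T x) I; exists u.
have injS u v : S u = S v -> u = v by exact: (Emb_inj subspace_setT SI.1).
exists R => //; split; last first.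
  move=> z _; have [u _ uz] := TI.2 (S z) I.
  by exists u => //; apply: injS; rewrite SR.
split=> // [a x y _ _|x _].
  by apply: injS; rewrite (Isom_linear _ _ _ SI) !SR Isom_linear.
by rewrite -(Isom_norm _ SI) SR Isom_norm.
Qed.

(** * The filter of isometries close to an embedding *)

Definition pointwise_close Y t s (d : K) : set (X -> X) :=
  [set T | Isom setT T /\ forall y, y \in s -> Y y -> `|t y - T y| <= d].

(** Trace on the surjective isometries of [X] of the neighborhoods of [t] for
    pointwise convergence on [Y]. *)
Definition pointwise Y t : set_system (X -> X) :=
  filter_from [set p : seq X * K | 0 < p.2]
              (fun p => pointwise_close Y t p.1 p.2).

Lemma pointwise_closeS Y t s s' d d' : {subset s <= s'} -> d' <= d ->
  pointwise_close Y t s' d' `<=` pointwise_close Y t s d.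
Proof.
move=> ss' dd' T [TI tT]; split=> // y ys Yy.
by apply: le_trans dd'; apply: tT => //; exact: ss'.
Qed.

Lemma pos_lower_bound (d d' : K) : 0 < d -> 0 < d' ->
  exists2 e, 0 < e & e <= d /\ e <= d'.
Proof.
move=> d0 d'0; have /orP[dd'|d'd] := real_leVge (gtr0_real d0) (gtr0_real d'0).
  by exists d.
by exists d'.
Qed.

Global Instance pointwise_filter Y t : Filter (pointwise Y t).
Proof.
apply: filter_from_filter; first by exists ([::], 1) => /=.
move=> [s d] [s' d'] /= d0 d'0.
have [e e0 [ed ed']] := pos_lower_bound d0 d'0.
exists (s ++ s', e) => //= T TC; split.
  by apply: pointwise_closeS TC => // y ys; rewrite mem_cat ys.
by apply: pointwise_closeS TC => // y ys; rewrite mem_cat ys orbT.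
Qed.

Lemma pointwise_Isom Y t : \forall T \near pointwise Y t, Isom setT T.
Proof. by exists ([::], 1) => //= T []. Qed.

Lemma pointwise_near Y t y e : Y y -> 0 < e ->
  \forall T \near pointwise Y t, `|t y - T y| <= e.
Proof.
by move=> Yy e0; exists ([:: y], e) => //= T [_]; apply; rewrite ?inE.
Qed.

Lemma pointwise_cvg Y t y : Y y -> T y @[T --> pointwise Y t] --> t y.
Proof. by move=> Yy; apply/cvgrPdist_le => e e0; exact: pointwise_near. Qed.

Lemma directed_tails_filter (I : Type) (le : I -> I -> Prop) :
  directed le -> Filter (tails le).
Proof.
move=> [[i0] _ letrans leub].
apply: filter_from_filter => [|i j _ _]; first by exists i0.
have [k [ik jk]] := leub i j; exists k => // l kl.
by split; [exact: letrans kl|exact: letrans kl].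
Qed.

(** Convergence along all nets of isometries is convergence along one filter.
    One inclusion uses the net canonically attached to the filter, indexed by
    the isometries [T] together with a finite set of points and a tolerance for
    which [T] is close to the identity; for the other, a net that converges on
    [Y] is finer than the filter. *)
Lemma Env_pointwise Y : Env Y = [set x | T x @[T --> pointwise Y id] --> x].
Proof.
apply/seteqP; split=> x /= => [Yx|lim_x I le T dirle TI TY].
  pose I := {p : (X -> X) * seq X * K | 0 < p.2 &
    pointwise_close Y id p.1.2 p.2 p.1.1}.
  pose net (i : I) := (s2val i).1.1.
  pose le (i j : I) := {subset (s2val i).1.2 <= (s2val j).1.2} /\
    (s2val j).2 <= (s2val i).2.
  have idC s d : 0 < d -> pointwise_close Y id s d id.
    by move=> d0; split=> [|y _ _]; [exact: Isom_id|rewrite subrr normr0 ltW].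
  have index T s d (d0 : 0 < d) (TC : pointwise_close Y id s d T) :
    exists i : I, s2val i = (T, s, d) by exists (exist2 _ _ (T, s, d) d0 TC).
  have dirI : directed le.
    split.
    - by have [i0 _] := index _ [::] _ ltr01 (idC _ _ ltr01).
    - by move=> i; split.
    - move=> j i k [ij dji] [jk dkj]; split=> [y /ij/jk|]//.
      exact: le_trans dkj _.
    move=> i j; have [e e0 [ei ej]] := pos_lower_bound (s2valP i) (s2valP j).
    have [k kE] := index _ ((s2val i).1.2 ++ (s2val j).1.2) _ e0 (idC _ _ e0).
    exists k; split; rewrite /le kE; split=> //= y ys;
      by rewrite mem_cat ys ?orbT.
  have netI i : Isom setT (net i) by have [] := s2valP' i.
  have tF : Filter (tails le) := directed_tails_filter dirI.
  have netY y : Y y -> net i y @[i --> tails le] --> y.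
    move=> Yy; apply/cvgrPdist_le => e e0.
    have [i iE] := index _ [:: y] _ e0 (idC _ _ e0).
    exists i => // j []; rewrite iE /= => ys dj.
    have [_ /(_ y)] := s2valP' j.
    by move/(_ (ys _ (mem_head _ _)) Yy)/le_trans; exact.
  have /cvgrPdist_le netx := Yx I le net dirI netI netY.
  apply/cvgrPdist_le => e e0; have [i _ ie] := netx e e0.
  exists ((s2val i).1.2, (s2val i).2); first exact: s2valP i.
  move=> T TC.
  have [j jE] := index _ _ _ (s2valP i) TC.
  by have /= := ie j; rewrite /le /net jE; apply; split.
have tF : Filter (tails le) := directed_tails_filter dirle.
have netF : T i @[i --> tails le] --> pointwise Y id.
  move=> A [[s d] /= d0 CA].
  suff : \forall i \near tails le,
      forall y, y \in s -> Y y -> `|y - T i y| <= d.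
    by apply: filterS => i tT; apply: CA.
  elim: s {CA} => [|y s IHs]; first exact: nearW.
  have [Yy|nYy] := pselect (Y y); last first.
    apply: filterS IHs => i IHs z.
    by rewrite inE => /predU1P[->/nYy//|]; exact: IHs.
  have /cvgrPdist_le/(_ _ d0) := TY _ Yy.
  apply: filterS2 IHs => i IHs yd z.
  by rewrite inE => /predU1P[->//|]; exact: IHs.
exact: cvg_comp netF lim_x.
Qed.

Lemma pointwise_cvg_close Y t x z e :
  T x @[T --> pointwise Y t] --> z -> 0 < e ->
  exists s, exists2 d, 0 < d &
    pointwise_close Y t s d `<=` [set T | `|z - T x| <= e].
Proof.
move=> /cvgrPdist_le xz e0; have [[s d] /= d0 sd] := xz e e0.
by exists s, d.
Qed.

Lemma pointwise_close_near Y t s d : 0 < d ->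
  \forall T \near pointwise Y t, pointwise_close Y t s d T.
Proof. by move=> d0; exists (s, d). Qed.

Lemma sub_Env Y : Y `<=` Env Y.
Proof. by move=> y Yy; rewrite Env_pointwise; exact: (@pointwise_cvg Y id). Qed.

Lemma pointwise_cvg_linear Y t a x y u v :
  T x @[T --> pointwise Y t] --> u -> T y @[T --> pointwise Y t] --> v ->
  T (a *: x + y) @[T --> pointwise Y t] --> a *: u + v.
Proof.
move=> xu yv; apply: cvg_trans (cvgD (cvgZl_tmp (k := a) xu) yv).
apply: near_eq_cvg; apply: filterS (pointwise_Isom Y t) => T TI.
by rewrite /= Isom_linear.
Qed.

Lemma subspace_Env Y : linear_subspace Y -> linear_subspace (Env Y).
Proof.
move=> [Y0 _]; split=> [|a x y].
  by apply/mem_set/sub_Env/set_mem.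
rewrite Env_pointwise => /set_mem Yx /set_mem Yy; apply/mem_set.
exact: pointwise_cvg_linear.
Qed.

Lemma pointwise_cvg_unique Y t x u v : ProperFilter (pointwise Y t) ->
  T x @[T --> pointwise Y t] --> u -> T x @[T --> pointwise Y t] --> v -> u = v.
Proof.
move=> tP xu xv.
by apply: (@norm_cvg_unique _ _ (fmap (fun T : X -> X => T x) (pointwise Y t))).
Qed.

(** On the span [F] of the points of [s] that lie in [Y], approximate
    ultrahomogeneity bounds [T - t] on the unit ball; by homogeneity the error
    at a point [y] of [s] is at most [`|y|] times that bound. *)
Lemma AUH_pointwise Y t : AUH X -> linear_subspace Y -> Emb Y setT t ->
  ProperFilter (pointwise Y t).
Proof.
move=> hX sY tE; have [_ lt nt] := tE; have [Y0 lY] := sY.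
apply: filter_from_proper => -[s d] /= d0.
pose s' := [seq y <- s | `[<Y y>]].
pose F := [set x | exists a : 'I_(size s') -> K, x = \sum_i a i *: s'`_i].
have FY : F `<=` Y.
  move=> _ [a ->]; apply/set_mem; elim/big_ind: _ => // [x y Yx Yy|i _].
    by rewrite -[x]scale1r lY.
  rewrite -[X in X \in _]addr0; apply: lY => //; apply/mem_set/asboolP.
  by have := mem_nth 0 (ltn_ord i); rewrite mem_filter => /andP[].
have sF y a : y \in s -> Y y -> F (a *: y).
  move=> ys Yy.
  have ys' : y \in s' by rewrite mem_filter ys andbT; apply/asboolP.
  have yi : (index y s' < size s')%N by rewrite index_mem.
  exists (fun i => if i == Ordinal yi then a else 0).
  rewrite (bigD1 (Ordinal yi))//= eqxx nth_index// big1 ?addr0// => i /negPf->.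
  by rewrite scale0r.
(* [N] bounds the norms of the points of [s]; adding 1 makes it invertible. *)
pose N := 1 + \sum_(y <- s) `|y|.
have N0 : 0 < N by rewrite ltr_wpDr// sumr_ge0.
have finF : finite_dim_subspace F by exists (size s'), (fun i => s'`_i).
have FE : Emb F setT t by exact: Emb_sub FY _ tE.
have [T TI Tt] := hX F t finF FE (d / N) (divr_gt0 d0 N0).
exists T; split=> // y ys Yy.
have [->|y0] := eqVneq y 0.
  by rewrite (linear_on0 sY lt) (Isom0 TI) subrr normr0 ltW.
have ny0 : 0 < `|y| by rewrite normr_gt0.
have yN : `|y| <= N.
  rewrite /N (big_rem y)//= addrCA lerDl addr_ge0// sumr_ge0//.
have := Tt _ (sF y `|y|^-1 ys Yy).
rewrite normrZ normfV normr_id mulVf ?gt_eqF// => /(_ (lexx _)).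
rewrite (linear_onZ _ sY lt)// IsomZ// -scalerBr normrZ normfV normr_id.
rewrite distrC ler_pdivrMl// => /le_trans; apply.
by rewrite mulrCA ler_piMr ?(ltW d0)// ler_pdivrMr// mul1r.
Qed.

(** * Propagation of convergence to the envelope *)

(** Closeness of [S] and [T] on [Y] is closeness of [S^-1 T] to the identity,
    which propagates to [x] by definition of the envelope. *)
Lemma Env_uniform Y x e : Env Y x -> 0 < e ->
  exists s, exists2 d, 0 < d & forall S T, Isom setT S -> Isom setT T ->
    (forall y, y \in s -> Y y -> `|S y - T y| <= d) -> `|S x - T x| <= e.
Proof.
rewrite Env_pointwise => Yx e0.
have [s [d d0 sd]] := pointwise_cvg_close Yx e0.
exists s, d => // S T SI TI ST; have [R RI SR] := Isom_quotient SI TI.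
rewrite -SR Isom_dist//; apply: sd; split=> // y ys Yy.
by rewrite -(Isom_dist _ _ SI) SR; exact: ST.
Qed.

(** Approximate [f] on [Env Y] by an isometry [S].  An isometry [T] close to
    [t], that is to [f], on [Y] is close to [S] on [Y], hence at [x]. *)
Lemma Emb_Env_is_limit Y t f x : AUH X -> linear_subspace Y ->
  Emb (Env Y) setT f ->
  (forall y, Y y -> f y = t y) -> Env Y x ->
  T x @[T --> pointwise Y t] --> f x.
Proof.
move=> hX sY fE ft Yx; apply/cvgrPdist_le => e e0.
have e20 : 0 < e / 2 by rewrite divr_gt0.
have [s [d d0 sd]] := Env_uniform Yx e20.
have d20 : 0 < d / 2 by rewrite divr_gt0.
have fP := AUH_pointwise hX (subspace_Env sY) fE.
have [S [Sx [SI Ss]]] := @filter_ex _ _ fP _ (filterI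
  (@pointwise_near (Env Y) f x _ Yx e20)
  (@pointwise_close_near (Env Y) f s _ d20)).
apply: filterS (pointwise_close_near Y t s d20) => T [TI tT].
rewrite (splitr e) (le_trans (ler_distD (S x) _ _))// lerD//.
apply: sd => // y ys Yy.
rewrite (splitr d) (le_trans (ler_distD (f y) _ _))// lerD//.
  by rewrite distrC; apply: Ss => //; exact: sub_Env.
by rewrite ft//; exact: tT.
Qed.

(** For [S] close to [t] on [Y], an isometry [U] that nearly fixes points of
    [t Y] makes [U S] close to [S] on [Y], hence at [x]; so [U] nearly fixes
    [S x], which is close to [z]. *)
Lemma Env_image Y t x z : ProperFilter (pointwise Y t) -> Env Y x ->
  T x @[T --> pointwise Y t] --> z -> Env (t @` Y) z.
Proof.
move=> tP Yx /cvgrPdist_le xz; rewrite Env_pointwise.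
apply/cvgrPdist_le => e e0.
have e30 : 0 < e / 3 by rewrite divr_gt0.
have [s [d d0 sd]] := Env_uniform Yx e30.
have d30 : 0 < d / 3 by rewrite divr_gt0.
have third (a : K) : a = a / 3 + a / 3 + a / 3.
  by rewrite -mulr2n -mulrSr -[RHS]mulr_natr divfK// pnatr_eq0.
have [S [Sx [SI Ss]]] := @filter_ex _ _ tP _ (filterI
  (xz _ e30) (pointwise_close_near Y t s d30)).
apply: filterS (pointwise_close_near (t @` Y) id (map t s) d30) => U [UI tU].
have US : Isom setT (U \o S) by exact: Isom_comp.
(* If [U] nearly fixes [v], it nearly fixes the points near [v]; this serves
   both to pass from [t y] to [S y] and to pass from [S x] to [z]. *)
have near_fix u v a : `|u - v| <= a / 3 -> `|v - U v| <= a / 3 ->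
    `|u - U u| <= a.
  move=> uv vU; rewrite (third a) (le_trans (ler_distD (U v) _ _))// lerD//.
    by rewrite (le_trans (ler_distD v _ _))// lerD.
  by rewrite Isom_dist// distrC.
apply: (near_fix _ (S x)) => //; apply: (sd S (U \o S)) => // y ys Yy.
apply: (near_fix _ (t y)); first by rewrite distrC; exact: Ss.
by apply: tU; [exact: map_f|exists y].
Qed.

End normed_space.

(** * Extension to the envelope *)

Section banach_space.
Import Order.TTheory GRing.Theory Num.Theory.
Set Implicit Arguments.
Unset Strict Implicit.
Unset Printing Implicit Defensive.
Context {K : numFieldType} {X : completeNormedModType K}.
Context (hX : AUH X).
Implicit Types (Y Z : set X) (f t S T U : X -> X) (s : seq X) (x y z u v w : X).

(** Two isometries close to [t] on [Y] are close to each other there, hence at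
    [x]: the images of [x] form a Cauchy filter. *)
Lemma Env_cvg Y t x : ProperFilter (pointwise Y t) -> Env Y x ->
  exists z, T x @[T --> pointwise Y t] --> z.
Proof.
move=> tP Yx.
suff /cauchy_cvg/cvg_ex : cauchy (T x @[T --> pointwise Y t]) by [].
apply: cauchy_exP => e e0.
have e20 : 0 < e / 2 by rewrite divr_gt0.
have [s [d d0 sd]] := Env_uniform Yx e20.
have d20 : 0 < d / 2 by rewrite divr_gt0.
have st := pointwise_close_near Y t s d20.
have [S [SI Ss]] := @filter_ex _ _ tP _ st.
exists (S x); apply: filterS st => T [TI Ts].
rewrite -ball_normE /=; apply: le_lt_trans (_ : _ <= e / 2) _; last first.
  by rewrite ltr_pdivrMr// ltr_pMr// ltr1n.
apply: sd => // y ys Yy.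
rewrite (splitr d) (le_trans (ler_distD (t y) _ _))// lerD ?Ts//.
by rewrite distrC; exact: Ss.
Qed.

(** The extension [g] is the pointwise limit of the isometries of [X] that
    converge to [t] on [Y]. *)
Lemma Emb_Env Y t : linear_subspace Y -> Emb Y setT t ->
  exists2 g, Emb (Env Y) (Env (t @` Y)) g & forall y, Y y -> g y = t y.
Proof.
move=> sY tE; have tP := AUH_pointwise hX sY tE.
have /choice[g gP] : forall x, exists z,
    Env Y x -> T x @[T --> pointwise Y t] --> z.
  move=> x; have [/(Env_cvg tP)[z xz]|nYx] := pselect (Env Y x).
    by exists z.
  by exists 0.
exists g; last first.
  move=> y Yy.
  apply: (pointwise_cvg_unique (x := y) tP); last exact: pointwise_cvg.
  by apply: gP; exact: sub_Env.
split=> [x Yx|a x y Yx Yy|x Yx].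
- exact: Env_image (gP _ Yx).
- apply: (pointwise_cvg_unique (x := a *: x + y) tP).
    apply: gP; apply/set_mem; have [_ lE] := subspace_Env sY.
    by apply: lE; exact/mem_set.
  exact: pointwise_cvg_linear (gP _ Yx) (gP _ Yy).
- have nT := cvg_norm (gP _ Yx).
  apply: (@norm_cvg_unique _ _
    (fmap (fun T : X -> X => `|T x|) (pointwise Y t))).
    exact: nT.
  apply: cvg_near_cst.
  by apply: filterS (pointwise_Isom Y t) => T /Isom_norm ->.
Qed.

(** Both maps are the pointwise limit of the isometries of [X] that converge to
    [g] on [Y]. *)
Lemma Emb_Env_unique Y f g x : linear_subspace Y ->
  Emb (Env Y) setT f -> Emb (Env Y) setT g ->
  (forall y, Y y -> f y = g y) -> Env Y x -> f x = g x.
Proof.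
move=> sY fE gE fg Yx.
have gY : Emb Y setT g by exact: Emb_sub (@sub_Env _ _ Y) _ gE.
have gP := AUH_pointwise hX sY gY.
exact: pointwise_cvg_unique gP (Emb_Env_is_limit hX sY fE fg Yx)
  (Emb_Env_is_limit hX sY gE (fun _ _ => erefl) Yx).
Qed.

(** The extension [h] of the inverse [r] of [t] is a right inverse of [g]:
    [g \o h] is the identity on [t Y], hence on its envelope by uniqueness. *)
Lemma Emb_Env_surj Y t : linear_subspace Y -> Emb Y setT t ->
  exists2 g, Emb (Env Y) (Env (t @` Y)) g /\
             set_surj (Env Y) (Env (t @` Y)) g &
             forall y, Y y -> g y = t y.
Proof.
move=> sY tE; have [g gE gt] := Emb_Env sY tE; exists g => //; split=> // z Wz.
have sW := subspace_image sY tE.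
have /choice[r rP] : forall w, exists y, (t @` Y) w -> Y y /\ t y = w.
  move=> w; have [[y Yy yw]|nw] := pselect ((t @` Y) w); first by exists y.
  by exists 0.
have [_ lt nt] := tE.
have rt y : Y y -> r (t y) = y.
  move=> Yy; have [Yr tr] := rP (t y) (ex_intro2 _ _ y Yy erefl).
  exact: (Emb_inj sY tE).
have rE : Emb (t @` Y) setT r.
  split=> // [a _ _ [x Yx <-] [y Yy <-]|_ [x Yx <-]]; last by rewrite rt ?nt.
  have [_ lY] := sY; rewrite -lt// !rt//.
  by apply/set_mem/lY; exact/mem_set.
have [h hE hr] := Emb_Env sW rE.
have rY : r @` (t @` Y) = Y.
  apply/seteqP; split=> [_ [_ [y Yy <-] <-]|y Yy]; first by rewrite rt.
  by exists (t y); [exists y|exact: rt].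
rewrite rY in hE; have [hf lh nh] := hE; have [gf lg ng] := gE.
exists (h z); first exact: hf.
apply: (@Emb_Env_unique (t @` Y) (g \o h) id) => // [|_ [y Yy <-]].
- split=> // [a u v Wu Wv|u Wu] /=.
    by rewrite lh// lg//; exact: hf.
  by rewrite ng ?nh//; exact: hf.
- by rewrite /= hr ?rt ?gt//; exists y.
Qed.

(** By uniqueness, an isometry [S] of [Env Y] that extends [gamma] is the
    extension [g], whose range is [Env (gamma Y)]. *)
Lemma Env_image_eq_iff_ext Y gamma : linear_subspace Y -> Emb Y (Env Y) gamma ->
  Env (gamma @` Y) = Env Y <-> Emb_ext Y (Env Y) gamma.
Proof.
move=> sY gammaE; have gE : Emb Y setT gamma by exact: Emb_sub _ _ gammaE.
have [g [gEnv gsurj] gg] := Emb_Env_surj sY gE.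
split=> [eqE|[S [SE Ssurj] Sg]].
  by exists g => [|y /gg]//; rewrite eqE in gEnv gsurj.
have gS x : Env Y x -> g x = S x.
  apply: Emb_Env_unique => //; [exact: Emb_sub _ _ gEnv|exact: Emb_sub _ _ SE|].
  by move=> y Yy; rewrite gg ?Sg.
apply/seteqP; split=> x.
  move=> /gsurj[u Yu <-]; rewrite gS//.
  by have [Sf _ _] := SE; exact: Sf.
move=> /Ssurj[u Yu <-]; rewrite -gS//.
by have [gf _ _] := gEnv; exact: gf.
Qed.

End banach_space.

Theorem corollary2p41 (K : numFieldType) (X : completeNormedModType K)
    (hX : AUH X) :
  (forall (Y : set X) (gamma : X -> X),
    linear_subspace Y -> Emb Y (Env Y) gamma ->
    (Env (gamma @` Y) = Env Y <-> Emb_ext Y (Env Y) gamma)) /\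
  (forall (Y1 Y2 : set X) (t : X -> X),
    linear_subspace Y1 -> linear_subspace Y2 -> full Y1 -> full Y2 ->
    Emb Y1 Y2 t -> set_surj Y1 Y2 t ->
    Emb_ext Y1 [set: X] t).
Proof.
split=> [Y gamma sY gE|Y1 Y2 t sY1 _ full1 full2 tE tsurj].
  exact: Env_image_eq_iff_ext.
have tY : t @` Y1 = Y2.
  by apply/seteqP; split=> [_ [y Yy <-]|//]; have [tf _ _] := tE; exact: tf.
rewrite -full1; apply/(Env_image_eq_iff_ext hX sY1); last by rewrite tY full1.
by rewrite full1; exact: Emb_sub _ _ tE.
Qed.
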